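(* Let $G=(V,E,\bm{\pi})$ be a connected, locally uniformly finite and stochastically complete weighted graph (satisfying the standing assumptions in the context). Let $\mathcal{J}\in C^2(\mathcal{P}(G))$ be a functional with $\frac{\delta}{\delta\bm{\rho}}\mathcal{J}\in\mathcal{K}_{\bm{\rho}}(V,\bm{\pi})$. Then the gradient flow of $\mathcal{J}$ on $(\mathcal{P}_0(G),\mathcal{W}_2)$ is $$\dot{\bm{\rho}}(t)=-B_{\bm{\rho}}\frac{\delta}{\delta\bm{\rho}}\mathcal{J}(\bm{\rho}),$$ or equivalently $$\frac{\mathrm{d}\bm{\rho}}{\mathrm{d}t}=\mathrm{div}_G\Big(\bm{\rho}\nabla_G\Big(\frac{\delta}{\delta\bm{\rho}}\mathcal{J}(\bm{\rho})\Big)\Big).$$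
   Context: **Graph.** $V=\{x_i\}_{i\in\mathbb{N}}$ is countably infinite; the graph is undirected, without loops or multiple edges, and connected. Edge weights $\omega_{ij}=\omega_{ji}$ satisfy $\omega_{ij}>0$ if $\{x_i,x_j\}\in E$ and $\omega_{ij}=0$ otherwise, with $\inf_{i\sim j}\omega_{ij}>0$ and $\sup_{i,j}\omega_{ij}<\infty$. Put $N(i)=\{j:\{x_i,x_j\}\in E\}$. Locally uniformly finite means $|N(i)|\le C_V$ for all $i$, for a constant $C_V\ge1$. The vertex measure is $\pi_i=\sum_{j\in N(i)}\omega_{ij}$ and satisfies $\sum_i\pi_i=\infty$, $\inf_i\pi_i>0$, and $\pi_j\le K_0\pi_i$ for all adjacent $x_i,x_j$, for a constant $K_0>0$. $C(V)$ and $C(V^2)$ are the real functions on $V$ and $V\times V$. $\ell^1(V,\bm{\pi})$ is the space of $f\in C(V)$ with $\sum_i\pi_i|f(x_i)|<\infty$. $\langle f,g\rangle_{\bm{\pi}}=\sum_if(x_i)g(x_i)\pi_i$. **Stochastic completeness.** With $\Delta_G\phi(x_i)=\sum_{j\in N(i)}\frac{\omega_{ij}}{\pi_i}(\phi(x_j)-\phi(x_i))$, a fundamental solution of $u_t=\Delta_Gu$ is $h:(0,\infty)\times V\times V\to\mathbb{R}$ such that for every bounded $u^0\in C(V)$, $u(t,x_i)=\sum_jh(t,x_i,x_j)u^0(x_j)\pi_j$ is differentiable in $t$, solves $u_t=\Delta_Gu$, and tends to $u^0(x_i)$ as $t\to0^+$ for every $i$. $G$ is stochastically complete if $\sum_jh(t,x_i,x_j)\pi_j=1$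 for all $t>0$ and all $i$. **Gradient and divergence.** $\nabla_G\phi(x_i,x_j)=\phi(x_j)-\phi(x_i)$ if $\{x_i,x_j\}\in E$ and $0$ otherwise. $\mathcal{P}(G)=\{\bm{\rho}=(\rho_i)_{i=1}^\infty:\rho_i\ge0,\ \sum_i\rho_i\pi_i=1\}$ and $\mathcal{P}_0(G)$ is its subset with all $\rho_i>0$. The logarithmic mean is $\hat\rho(x_i,x_j)=\frac{\rho_i-\rho_j}{\log\rho_i-\log\rho_j}$ if $\{x_i,x_j\}\in E$ and $\rho_i,\rho_j>0$ (equal to $\rho_i$ when $\rho_i=\rho_j$), and $0$ otherwise. For $\Phi\in C(V^2)$, $\mathrm{div}_G(\bm{\rho}\Phi)(x_i)=\sum_{j\in N(i)}\frac{\omega_{ij}}{\pi_i}\Phi(x_i,x_j)\hat\rho(x_i,x_j)$. **Metric $\mathcal{W}_2$.** For $\bm{\rho}\in\mathcal{P}_0(G)$ let $\mathcal{K}_{\bm{\rho}}(V,\bm{\pi})=\{\bm{p}\in C(V):\mathrm{div}_G(\bm{\rho}\nabla_G\bm{p})\in\ell^1(V,\bm{\pi})\}$ and $B_{\bm{\rho}}:\mathcal{K}_{\bm{\rho}}(V,\bm{\pi})\to\ell^1(V,\bm{\pi})$, $B_{\bm{\rho}}\bm{p}=-\mathrm{div}_G(\bm{\rho}\nabla_G\bm{p})$; $T_{\bm{\rho}}\mathcal{P}_0(G)=\{\bm{\sigma}\in\mathrm{Ran}(B_{\bm{\rho}}):\sum_i\sigma_i\pi_i=0\}$; $B_{\bm{\rho}}^{-1}\bm{\sigma}$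 is any $\bm{p}\in\mathcal{K}_{\bm{\rho}}(V,\bm{\pi})$ with $B_{\bm{\rho}}\bm{p}=\bm{\sigma}$ (determined up to an additive constant). The inner product on $T_{\bm{\rho}}\mathcal{P}_0(G)$ is $$g^{(2)}_{\bm{\rho}}(\bm{\sigma}^1,\bm{\sigma}^2)=\langle\bm{\sigma}^1,B_{\bm{\rho}}^{-1}\bm{\sigma}^2\rangle_{\bm{\pi}}=\langle B_{\bm{\rho}}\bm{p}^1,\bm{p}^2\rangle_{\bm{\pi}}=\tfrac12\sum_i\sum_{j\in N(i)}\omega_{ij}\nabla_G\bm{p}^1(x_i,x_j)\nabla_G\bm{p}^2(x_i,x_j)\hat\rho(x_i,x_j),\quad\bm{\sigma}^k=B_{\bm{\rho}}\bm{p}^k,$$ and $\mathcal{W}_2^2(\bm{\rho}^1,\bm{\rho}^2)=\inf\int_0^1g^{(2)}_{\bm{\rho}}(\dot{\bm{\rho}},\dot{\bm{\rho}})\,\mathrm{d}t$ over continuously differentiable curves $\bm{\rho}:[0,1]\to\mathcal{P}_0(G)$ from $\bm{\rho}^1$ to $\bm{\rho}^2$. **Gradient flow.** $\frac{\delta}{\delta\bm{\rho}}\mathcal{J}(\bm{\rho})\in C(V)$ is the derivative of $\mathcal{J}$ with respect to $\langle\cdot,\cdot\rangle_{\bm{\pi}}$, i.e. $\frac{\mathrm{d}}{\mathrm{d}t}\mathcal{J}(\bm{\rho}(t))=\langle\frac{\delta}{\delta\bm{\rho}}\mathcal{J}(\bm{\rho}),\dot{\bm{\rho}}\rangle_{\bm{\pi}}$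 along curves. The gradient flow of $\mathcal{J}$ on $(\mathcal{P}_0(G),\mathcal{W}_2)$ is the evolution equation for curves $\bm{\rho}(t)$ in $\mathcal{P}_0(G)$ (with $\dot{\bm{\rho}}\in T_{\bm{\rho}}\mathcal{P}_0(G)$) defined by $$g^{(2)}_{\bm{\rho}}(\dot{\bm{\rho}},\bm{\sigma})=-\Big\langle\frac{\delta}{\delta\bm{\rho}}\mathcal{J}(\bm{\rho}),\bm{\sigma}\Big\rangle_{\bm{\pi}}\quad\text{for all }\bm{\sigma}\in T_{\bm{\rho}}\mathcal{P}_0(G).$$
   Formalization: The preimage B_ρ^{-1}σ is taken among p in K_ρ of finite Dirichlet energy, and the velocity and test vectors σ range over those in T_ρ having such a preimage; for arbitrary p in K_ρ it is not unique up to a constant (e.g. on Z) and g^(2) is ill-defined. *)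

(* Defs.v *)
From HB Require Import structures.
From mathcomp Require Import all_boot all_order all_algebra.
From mathcomp Require Import all_classical all_reals all_analysis.

Set Implicit Arguments.
Unset Strict Implicit.
Unset Printing Implicit Defensive.

Import Order.TTheory GRing.Theory Num.Theory numFieldNormedType.Exports.

Local Open Scope classical_set_scope.
Local Open Scope ring_scope.

(* The vertex x_i is identified with its index i, so C(V) is nat -> R and
   C(V^2) is nat -> nat -> R. *)

Section Sums.
Variable R : realType.
Implicit Types u : nat -> R.

(* tsum u is meaningful only when the series converges. *)
Definition tsum u : R := limn (series u).
Definition abs_summable u : Prop := cvgn (series (fun i => `|u i|)).
End Sums.

Section Graph.
Variable R : realType.

Record wgraph := WGraph {
  adj : rel nat;
  wt : nat -> nat -> R }.

Variable G : wgraph.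

Definition nbr (i : nat) : set nat := [set j | adj G i j].

Definition vmeas (i : nat) : R := \sum_(j \in nbr i) wt G i j.

Definition connected_graph : Prop :=
  forall i j, exists p : seq nat, path (adj G) i p /\ last i p = j.

Definition locally_uniformly_finite : Prop :=
  exists CV : nat, (1 <= CV)%N /\ forall i, (nbr i #<= `I_CV)%card.

Record standing_assumptions : Prop := StandingAssumptions {
  adj_sym : symmetric (adj G);
  adj_irr : irreflexive (adj G);
  wt_sym : forall i j, wt G i j = wt G j i;
  wt_pos : forall i j, adj G i j -> 0 < wt G i j;
  wt_out : forall i j, ~~ adj G i j -> wt G i j = 0;
  wt_inf : exists2 c : R, 0 < c & forall i j, adj G i j -> c <= wt G i j;
  wt_sup : exists c : R, forall i j, wt G i j <= c;
  vmeas_sum : series vmeas @ \oo --> +oo;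
  vmeas_inf : exists2 c : R, 0 < c & forall i, c <= vmeas i;
  vmeas_adj : exists2 K0 : R, 0 < K0 &
    forall i j, adj G i j -> vmeas j <= K0 * vmeas i }.

Definition lapl (phi : nat -> R) (i : nat) : R :=
  \sum_(j \in nbr i) wt G i j / vmeas i * (phi j - phi i).

Definition heat_sol (h : R -> nat -> nat -> R) (u0 : nat -> R)
    (t : R) (i : nat) : R :=
  tsum (fun j => h t i j * u0 j * vmeas j).

Definition fundamental_solution (h : R -> nat -> nat -> R) : Prop :=
  forall u0 : nat -> R, (exists M : R, forall i, `|u0 i| <= M) ->
  forall i,
    (forall t : R, 0 < t ->
       cvgn (series (fun j => h t i j * u0 j * vmeas j)) /\
       is_derive t (1 : R) (fun s : R => heat_sol h u0 s i)
         (lapl (heat_sol h u0 t) i)) /\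
    heat_sol h u0 t i @[t --> 0^'+] --> u0 i.

Definition stochastically_complete : Prop :=
  exists2 h, fundamental_solution h &
    forall (t : R) i, 0 < t -> tsum (fun j => h t i j * vmeas j) = 1.

Definition l1 (f : nat -> R) : Prop := abs_summable (fun i => vmeas i * f i).
Definition l1norm (f : nat -> R) : R := tsum (fun i => vmeas i * `|f i|).
Definition ip (f g : nat -> R) : R := tsum (fun i => f i * g i * vmeas i).

Definition grad (phi : nat -> R) (i j : nat) : R :=
  if adj G i j then phi j - phi i else 0.

Definition prob (rho : nat -> R) : Prop :=
  (forall i, 0 <= rho i) /\
  series (fun i => rho i * vmeas i) @ \oo --> (1 : R).
Definition prob0 (rho : nat -> R) : Prop :=
  prob rho /\ forall i, 0 < rho i.

Definition logmean (rho : nat -> R) (i j : nat) : R :=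
  if [&& adj G i j, 0 < rho i & 0 < rho j] then
    if rho i == rho j then rho i
    else (rho i - rho j) / (ln (rho i) - ln (rho j))
  else 0.

Definition divG (rho : nat -> R) (Phi : nat -> nat -> R) (i : nat) : R :=
  \sum_(j \in nbr i) wt G i j / vmeas i * Phi i j * logmean rho i j.

Definition Kspace (rho p : nat -> R) : Prop := l1 (divG rho (grad p)).

Definition Bop (rho p : nat -> R) : nat -> R :=
  fun i => - divG rho (grad p) i.

Definition tangent (rho sigma : nat -> R) : Prop :=
  (exists2 p, Kspace rho p & Bop rho p = sigma) /\
  tsum (fun i => sigma i * vmeas i) = 0.

Definition dirichlet (rho p1 p2 : nat -> R) : R :=
  2^-1 * tsum (fun i => \sum_(j \in nbr i)
    wt G i j * grad p1 i j * grad p2 i j * logmean rho i j).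

Definition finite_energy (rho p : nat -> R) : Prop :=
  cvgn (series (fun i => \sum_(j \in nbr i)
    wt G i j * grad p i j ^+ 2 * logmean rho i j)).

(* The preimages p of sigma under B_rho are taken of finite energy: these are
   the ones for which g_rho(sigma, sigma) is a finite number, and they are
   unique up to an additive constant.  Without it the equation B_rho p = sigma
   may have further solutions: on Z with nearest-neighbour edges,
   p (i + 1) - p i = 1 / (wt i (i + 1) * logmean rho i (i + 1)) gives
   B_rho p = 0. *)
Definition potential (rho sigma p : nat -> R) : Prop :=
  [/\ Kspace rho p, finite_energy rho p & Bop rho p = sigma].

Definition has_potential (rho sigma : nat -> R) : Prop :=
  exists p, potential rho sigma p.

(* Some potential of sigma; the zero function when sigma has none. *)
Definition Binv (rho sigma : nat -> R) : nat -> R :=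
  xget (fun=> 0) [set p | potential rho sigma p].

Definition g2 (rho sigma1 sigma2 : nat -> R) : R :=
  dirichlet rho (Binv rho sigma1) (Binv rho sigma2).

Section Functionals.
Variable J : (nat -> R) -> R.

(* Directions tangent to the affine hull of P(G) in l^1(V, pi). *)
Definition l1_zero (sigma : nat -> R) : Prop :=
  l1 sigma /\ tsum (fun i => sigma i * vmeas i) = 0.

Definition linear_l1_zero (L : (nat -> R) -> R) : Prop :=
  forall (a : R) (sigma tau : nat -> R), l1_zero sigma -> l1_zero tau ->
    L (a *: sigma + tau) = a * L sigma + L tau.

(* Twice continuously Frechet differentiable on the convex subset P(G) of
   l^1(V, pi): D rho and D2 rho are the first and second derivatives. *)
Definition C2_prob : Prop :=
  exists (D : (nat -> R) -> (nat -> R) -> R)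
         (D2 : (nat -> R) -> (nat -> R) -> (nat -> R) -> R),
  forall rho, prob rho ->
  [/\ linear_l1_zero (D rho) /\
        (exists C : R, forall sigma, l1_zero sigma ->
           `|D rho sigma| <= C * l1norm sigma),
      [/\ forall sigma, l1_zero sigma -> linear_l1_zero (D2 rho sigma),
          forall tau, l1_zero tau -> linear_l1_zero (D2 rho ^~ tau) &
          exists C : R, forall sigma tau, l1_zero sigma -> l1_zero tau ->
            `|D2 rho sigma tau| <= C * l1norm sigma * l1norm tau] &
      forall e : R, 0 < e -> exists2 d : R, 0 < d &
        forall mu, prob mu -> l1norm (mu - rho) < d ->
        [/\ `|J mu - J rho - D rho (mu - rho)| <= e * l1norm (mu - rho),
            forall sigma, l1_zero sigma ->
              `|D mu sigma - D rho sigma - D2 rho (mu - rho) sigma|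
                <= e * l1norm (mu - rho) * l1norm sigma &
            forall sigma tau, l1_zero sigma -> l1_zero tau ->
              `|D2 mu sigma tau - D2 rho sigma tau|
                <= e * l1norm sigma * l1norm tau]].

Definition deriv_within (I : set R) (f : R -> R) (t l : R) : Prop :=
  (f s - f t) / (s - t) @[s --> within I t^'] --> l.

(* c is continuously differentiable from [0, 1] to P(G) for the norm of
   l^1(V, pi), with velocity dc. *)
Definition C1_prob_curve (c dc : R -> nat -> R) : Prop :=
  forall t : R, 0 <= t <= 1 ->
  [/\ prob (c t), l1 (dc t),
      l1norm ((s - t)^-1 *: (c s - c t) - dc t)
        @[s --> within `[0, 1]%classic t^'] --> (0 : R) &
      l1norm (dc s - dc t) @[s --> within `[0, 1]%classic t^'] --> (0 : R)].

(* dJ rho is the derivative of J at rho with respect to <., .>_pi; it is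
   determined up to an additive constant, because velocities have zero mass. *)
Definition var_deriv (dJ : (nat -> R) -> nat -> R) : Prop :=
  forall c dc, C1_prob_curve c dc -> forall t : R, 0 <= t <= 1 ->
    abs_summable (fun i => dJ (c t) i * dc t i * vmeas i) /\
    deriv_within `[0, 1]%classic (J \o c) t (ip (dJ (c t)) (dc t)).
End Functionals.

Definition prob0_curve (I : interval R) (rho drho : R -> nat -> R) : Prop :=
  forall t : R, t \in I ->
    prob0 (rho t) /\
    forall i, deriv_within [set` I] (fun s => rho s i) t (drho t i).

Definition gradient_flow (dJ : (nat -> R) -> nat -> R) (I : interval R)
    (rho drho : R -> nat -> R) : Prop :=
  forall t : R, t \in I ->
  [/\ tangent (rho t) (drho t), has_potential (rho t) (drho t) &
      forall sigma, tangent (rho t) sigma -> has_potential (rho t) sigma ->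
        g2 (rho t) (drho t) sigma = - ip (dJ (rho t)) sigma].

End Graph.

(* Main.v *)
Require Import Defs.
From HB Require Import structures.
From mathcomp Require Import all_boot all_order all_algebra.
From mathcomp Require Import finmap.
From mathcomp Require Import all_classical all_reals all_analysis.
From mathcomp Require Import lra ring.
Import Order.TTheory GRing.Theory Num.Theory numFieldNormedType.Exports.
Local Open Scope classical_set_scope.
Local Open Scope ring_scope.

(* The derivative phi of J at rho has bounded oscillation: testing it along the
   curve that transfers the mass of j to i and using the Frechet derivative D
   gives |phi i - phi j| <= 2 (|D| + 1).  The conductances
   c_ij = wt_ij * logmean_ij have finite total mass, because
   logmean_ij <= rho_i + rho_j.  Hence bounded functions have finite energy, and
   Green's formula E(q, f) = <f, B q> holds for f bounded and q of finite energy.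
   Testing a finite-energy solution of B q = 0 against its truncations shows that
   q is constant along edges, so g_rho does not depend on the choice of
   potentials.  If p is a potential of the velocity, the gradient flow equation
   says that E(p + phi, .) vanishes on potentials; taking p + phi itself as test
   function gives grad (p + phi) = 0, that is velocity = - B phi.  The converse
   is Green's formula with f = phi. *)

Set Implicit Arguments.
Unset Strict Implicit.

(** * Finite sums, nonnegative series, two-term series, and right limits at zero *)

Lemma ler_fsumr (R : realType) (A : set nat) (f g : nat -> R) :
  finite_set A -> (forall i, A i -> f i <= g i) ->
  \sum_(i \in A) f i <= \sum_(i \in A) g i.
Proof.
move=> finA fg; rewrite !fsbig_finite// big_seq [leRHS]big_seq.
by apply: ler_sum => i; rewrite in_fset_set// inE => /fg.
Qed.

Lemma finite_set_nat_bounded (A : set nat) :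
  finite_set A -> exists m, A `<=` `I_m.
Proof.
move=> finA; exists (\max_(i <- fset_set A) i).+1 => i Ai /=.
by rewrite ltnS; apply: leq_bigmax_seq => //; rewrite in_fset_set// inE.
Qed.

Lemma nondecreasing_series_ge0 (R : realType) (u : nat -> R) :
  (forall i, 0 <= u i) -> {homo series u : n m / (n <= m)%N >-> n <= m}.
Proof. by move=> u0; apply: nondecreasing_series => i _ _; exact: u0. Qed.

Lemma cvgn_series_bounded (R : realType) (u : nat -> R) (M : R) :
  (forall i, 0 <= u i) -> (forall n, series u n <= M) ->
  cvgn (series u) /\ limn (series u) <= M.
Proof.
move=> u0 uM.
have cu : cvgn (series u).
  apply: nondecreasing_is_cvgn; first exact: nondecreasing_series_ge0.
  by exists M => _ [n _ <-].
by split=> //; apply: limr_le => //; apply: nearW.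
Qed.

Lemma abs_summable_cvgn (R : realType) (u : nat -> R) :
  abs_summable u -> cvgn (series u).
Proof. by move=> su; apply: normed_cvg. Qed.

Lemma tsum_ge0_eq0 (R : realType) (u : nat -> R) :
  (forall i, 0 <= u i) -> cvgn (series u) -> tsum u = 0 -> forall i, u i = 0.
Proof.
move=> u0 cu tu0 i; apply/eqP; rewrite eq_le u0 andbT.
have /(_ i.+1) := nondecreasing_cvgn_le (nondecreasing_series_ge0 u0) cu.
rewrite -[limn _]/(tsum u) tu0 seriesEnat/= big_nat_recr//=; apply: le_trans.
by rewrite lerDr sumr_ge0.
Qed.

Lemma series_pair_cvg (R : realType) (u : nat -> R) i j : i != j ->
  (forall k, k != i -> k != j -> u k = 0) ->
  series u @ \oo --> u i + u j.
Proof.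
move=> ij u0; apply: cvg_near_cst; exists (maxn i j).+1 => //= n.
rewrite /= gtn_max => /andP[ltin ltjn].
rewrite seriesEnat/= (bigD1_seq i) ?mem_index_iota ?iota_uniq//=; congr (_ + _).
rewrite big_mkcond (bigD1_seq j) ?mem_index_iota ?iota_uniq//=.
rewrite eq_sym ij big1 ?addr0// => k kj.
by case: ifP => // ki; rewrite u0.
Qed.

Lemma tsum_pair (R : realType) (u : nat -> R) i j : i != j ->
  (forall k, k != i -> k != j -> u k = 0) -> tsum u = u i + u j.
Proof. by move=> ij u0; apply/cvg_lim => //; exact: series_pair_cvg. Qed.

(** Turns a derivative at time 0 of a curve on [[0, 1]] into a limit as s decreases to 0, where s
    can be taken positive and small. *)
Lemma at_right_within01 (R : realType) :
  (0 : R)^'+ `=>` within `[0, 1]%classic (0 : R)^'.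
Proof.
rewrite /at_right /dnbhs /within/= => A /= nA.
near=> s => s0; have : s != 0 -> `[0, 1]%classic s -> A s by near: s.
apply; first by rewrite gt_eqF.
rewrite /= in_itv/= (ltW s0)/= (le_trans (ler_norm _))//.
Unshelve. all: by end_near. Qed.

(** * Sums over the oriented edges of a locally finite symmetric graph *)

Section EdgeSums.
Variables (R : realType) (N : nat -> set nat).
Hypothesis finN : forall i, finite_set (N i).
Hypothesis symN : forall i j, N i j -> N j i.
Implicit Types F H : nat -> nat -> R.

Definition rowsum F i : R := \sum_(j \in N i) F i j.

Definition edge_summable F := cvgn (series (rowsum (fun i j => `|F i j|))).

Lemma eq_rowsum F H : (forall i j, N i j -> F i j = H i j) ->
  rowsum F = rowsum H.
Proof.
by move=> FH; apply/funext => i; apply: eq_fsbigr => j; rewrite inE; apply: FH.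
Qed.

Lemma rowsumD F H : rowsum (fun i j => F i j + H i j) = rowsum F + rowsum H.
Proof. by apply/funext => i; rewrite /rowsum fsbig_split. Qed.

Lemma rowsumZ a F : rowsum (fun i j => a * F i j) = a *: rowsum F.
Proof. by apply/funext => i; rewrite /rowsum -mulr_fsumr. Qed.

Lemma rowsum_ge0 F : (forall i j, N i j -> 0 <= F i j) ->
  forall i, 0 <= rowsum F i.
Proof. by move=> F0 i; apply: fsumr_ge0 => j; apply: F0. Qed.

Lemma ler_norm_rowsum F i : `|rowsum F i| <= rowsum (fun i j => `|F i j|) i.
Proof. by rewrite /rowsum !fsbig_finite//; apply: ler_norm_sum. Qed.

Lemma edge_summable_le F H : (forall i j, N i j -> `|F i j| <= H i j) ->
  cvgn (series (rowsum H)) -> edge_summable F.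
Proof.
move=> FH; apply: series_le_cvg; [apply: rowsum_ge0 => //..|].
  by move=> i j /FH; apply: le_trans.
by move=> i; apply: ler_fsumr => // j; apply: FH.
Qed.

Lemma edge_summable_abs F : edge_summable F -> abs_summable (rowsum F).
Proof.
apply: series_le_cvg => // i; last exact: ler_norm_rowsum.
by apply: rowsum_ge0.
Qed.

Lemma edge_summable_cvgn F : edge_summable F -> cvgn (series (rowsum F)).
Proof. by move=> /edge_summable_abs; exact: abs_summable_cvgn. Qed.

Lemma nbhd_bounded n : exists m, forall i, (i < n)%N -> N i `<=` `I_m.
Proof.
have [|m Nm] := @finite_set_nat_bounded (\bigcup_(i in `I_n) N i).
  by apply: bigcup_finite => // i _.
by exists m => i ltin j Nij; apply: Nm; exists i.
Qed.

(** Entries F j i on edges with i < n have j < m, where m bounds all neighbours of the vertices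
    below n. *)
Lemma swap_partial F n : (forall i j, N i j -> 0 <= F i j) ->
  exists m, series (rowsum (fun i j => F j i)) n <= series (rowsum F) m.
Proof.
move=> F0; have [m Nm] := nbhd_bounded n; exists m.
rewrite !seriesEord /= !fsbig_ord.
pose E i j : R := if j \in N i then F i j else 0.
(* [E] extends [F] by zero off the edges, so that all rows share one index range and the finite sums
   can be exchanged. *)
have -> : \sum_(i \in `I_n) rowsum (fun i j => F j i) i =
    \sum_(i \in `I_n) \sum_(j \in `I_m) E j i.
  apply: eq_fsbigr => i; rewrite inE /= => ltin.
  rewrite /rowsum (eq_fsbigr (fun j => E j i)); last first.
    by move=> j; rewrite inE /E => /symN Nji; rewrite ifT// inE.
  apply: fsbig_widen; first exact: Nm.
  by move=> j [_ Nij]; rewrite /E/= ifF//; apply/negP; rewrite inE => /symN.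
rewrite exchange_fsbig//; apply: ler_fsumr => // j _.
have -> : rowsum F j = \sum_(i \in N j) E j i.
  by apply: eq_fsbigr => i; rewrite /E => ->.
(* Both index sets are embedded in their union: there [E] adds nothing outside [N j], and the terms
   outside [I_n] are nonnegative. *)
have finU : finite_set (`I_n `|` N j) by rewrite finite_setU; split.
rewrite (@fsbig_widen _ _ _ _ (N j) (`I_n `|` N j)); last 2 first.
- by move=> i; right.
- by move=> i [_ Nji]; rewrite /E/= ifF//; apply/negP; rewrite inE.
rewrite (fsbigID `I_n (`I_n `|` N j))// setUK lerDl.
by apply: fsumr_ge0 => i _; rewrite /E; case: ifP => //; rewrite inE => /F0.
Qed.

Lemma swap_cvgn_le F : (forall i j, N i j -> 0 <= F i j) ->
  cvgn (series (rowsum F)) ->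
  cvgn (series (rowsum (fun i j => F j i))) /\
  tsum (rowsum (fun i j => F j i)) <= tsum (rowsum F).
Proof.
move=> F0 cF; apply: cvgn_series_bounded.
  by apply: rowsum_ge0 => i j /symN; apply: F0.
move=> n; have [m /le_trans] := swap_partial n F0; apply.
apply: nondecreasing_cvgn_le => //.
by apply: nondecreasing_series_ge0; exact: rowsum_ge0.
Qed.

Lemma swap_cvgn F : (forall i j, N i j -> 0 <= F i j) ->
  cvgn (series (rowsum F)) -> cvgn (series (rowsum (fun i j => F j i))).
Proof. by move=> F0 /(swap_cvgn_le F0)[]. Qed.

(** Transposition is an involution, so the inequality of [swap_cvgn_le] also holds in reverse. *)
Lemma swap_tsum F : (forall i j, N i j -> 0 <= F i j) ->
  cvgn (series (rowsum F)) ->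
  tsum (rowsum (fun i j => F j i)) = tsum (rowsum F).
Proof.
move=> F0 cF; have [cF' le1] := swap_cvgn_le F0 cF.
have F0' i j : N i j -> 0 <= F j i by move=> /symN; exact: F0.
by apply/le_anti; rewrite le1; have [_ ->] := swap_cvgn_le F0' cF'.
Qed.

(* An antisymmetric F is P - P^T with P its positive part. *)
Lemma antisym_tsum_eq0 F : (forall i j, N i j -> F j i = - F i j) ->
  edge_summable F -> tsum (rowsum F) = 0.
Proof.
move=> aF sF; pose P i j := Num.max (F i j) 0.
have P0 i j : N i j -> 0 <= P i j by rewrite /P le_max lexx orbT.
have cP : cvgn (series (rowsum P)).
  apply: edge_summable_cvgn; apply: (edge_summable_le _ sF) => i j _.
  by rewrite /P; case: (leP (F i j) 0); rewrite ?normr0.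
have FE : rowsum F = rowsum P - rowsum (fun i j => P j i).
  rewrite -scaleN1r -rowsumZ -rowsumD; apply: eq_rowsum => i j Nij.
  rewrite /P (aF _ _ Nij).
  by case: (leP (F i j) 0) => ?; case: (leP (- F i j) 0) => ?; lra.
rewrite /tsum FE lim_seriesB//; last exact: swap_cvgn.
by rewrite -!/(tsum _) (swap_tsum P0)// subrr.
Qed.

End EdgeSums.

(** * Energy and flux on a network with finite total conductance *)

Lemma ler_normM_sqrD (R : realType) (x y : R) : `|x * y| <= x ^+ 2 + y ^+ 2.
Proof.
have := sqr_ge0 (x + y); have := sqr_ge0 (x - y).
have := sqr_ge0 x; have := sqr_ge0 y.
by rewrite ler_norml => *; apply/andP; split; nra.
Qed.

Section Network.
Variables (R : realType) (N : nat -> set nat) (c : nat -> nat -> R).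
Hypothesis finN : forall i, finite_set (N i).
Hypothesis symN : forall i j, N i j -> N j i.
Hypothesis c_gt0 : forall i j, N i j -> 0 < c i j.
Hypothesis c_sym : forall i j, N i j -> c j i = c i j.
Hypothesis c_total : cvgn (series (rowsum N c)).
Implicit Types f p q : nat -> R.

(** Every edge is counted in both orientations; the Dirichlet form is half of this sum. *)
Definition energy p q : R :=
  tsum (rowsum N (fun i j => c i j * (p j - p i) * (q j - q i))).

Definition finite_en q :=
  cvgn (series (rowsum N (fun i j => c i j * (q j - q i) ^+ 2))).

(** The net current leaving [i]; for the conductances [cond] below it is [Bop] times the vertex
    measure. *)
Definition flux q i : R := rowsum N (fun i j => c i j * (q i - q j)) i.

Lemma finite_en_pair p q : finite_en p -> finite_en q ->
  edge_summable N (fun i j => c i j * (p j - p i) * (q j - q i)).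
Proof.
move=> ep eq; apply: (edge_summable_le finN (H := fun i j =>
  c i j * (p j - p i) ^+ 2 + c i j * (q j - q i) ^+ 2)) => [i j Nij|];
  last first.
  by rewrite rowsumD//; apply: is_cvg_seriesD.
rewrite -mulrA normrM (gtr0_norm (c_gt0 Nij)) -mulrDr ler_pM2l ?c_gt0//.
exact: ler_normM_sqrD.
Qed.

Lemma finite_enD p q : finite_en p -> finite_en q ->
  finite_en (fun i => p i + q i).
Proof.
move=> ep eq; apply: (edge_summable_cvgn finN).
(* The factor 2 comes from (a + b)^2 <= 2 (a^2 + b^2). *)
apply: (edge_summable_le finN (H := fun i j =>
  2 * (c i j * (p j - p i) ^+ 2 + c i j * (q j - q i) ^+ 2))) => [i j Nij|].
  rewrite normrM (gtr0_norm (c_gt0 Nij)) -mulrDr mulrCA ler_pM2l ?c_gt0//.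
  rewrite ger0_norm ?sqr_ge0//.
  have := sqr_ge0 ((p j - p i) - (q j - q i)); nra.
by rewrite rowsumZ rowsumD//; apply/is_cvg_seriesZ/is_cvg_seriesD.
Qed.

Lemma finite_enN q : finite_en q -> finite_en (fun i => - q i).
Proof.
rewrite /finite_en => eq.
rewrite (@eq_rowsum _ _ _ (fun i j => c i j * (q j - q i) ^+ 2))//.
by move=> i j _; ring.
Qed.

(** The energy is at most M^2 times the total conductance. The bound is on the oscillation, which
    ignores additive constants. *)
Lemma bounded_finite_en f (M : R) :
  (forall i j, `|f i - f j| <= M) -> finite_en f.
Proof.
move=> fM; apply: (edge_summable_cvgn finN).
apply: (edge_summable_le finN (H := fun i j => M ^+ 2 * c i j)) => [i j Nij|].
  rewrite normrM (gtr0_norm (c_gt0 Nij)) mulrC ler_pM2r ?c_gt0// normrX.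
  by rewrite lerXn2r ?nnegrE// (le_trans _ (fM i j)).
by rewrite rowsumZ; apply: is_cvg_seriesZ.
Qed.

(* |x| <= 1 + x^2, and the total conductance is finite. *)
Lemma finite_en_flux q : finite_en q ->
  edge_summable N (fun i j => c i j * (q i - q j)).
Proof.
move=> eq; apply: (edge_summable_le finN (H := fun i j =>
  c i j + c i j * (q j - q i) ^+ 2)) => [i j Nij|]; last first.
  by rewrite rowsumD//; apply: is_cvg_seriesD.
rewrite normrM (gtr0_norm (c_gt0 Nij)) -{2}[c i j]mulr1 -mulrDr.
rewrite ler_pM2l ?c_gt0//; have := ler_normM_sqrD (q i - q j) 1.
rewrite mulr1 expr1n => /le_trans; apply.
by rewrite le_eqVlt; apply/orP; left; apply/eqP; ring.
Qed.

Lemma finite_en_flux_abs q : finite_en q -> abs_summable (flux q).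
Proof. by move=> /finite_en_flux/(edge_summable_abs finN). Qed.

Lemma flux_tsum_eq0 q : finite_en q -> tsum (flux q) = 0.
Proof.
move=> /finite_en_flux sq; apply: (antisym_tsum_eq0 finN symN _ sq).
by move=> i j Nij; rewrite (c_sym Nij); ring.
Qed.

(* The edge function c (dq) (f_i + f_j) is antisymmetric and sums to zero. *)
Lemma green f q (M : R) : (forall i, `|f i| <= M) -> finite_en q ->
  2^-1 * energy q f = tsum (fun i => f i * flux q i).
Proof.
move=> fM eq; have sq := finite_en_flux eq.
(* A bounded factor preserves the summability of the flux; 2 M bounds both f_i - f_j and f_i +
   f_j. *)
have sqM F : (forall i j, `|F i j| <= 2 * M) ->
    edge_summable N (fun i j => c i j * (q i - q j) * F i j).
  move=> FM; apply: (edge_summable_le finN (H := fun i j =>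
    2 * M * `|c i j * (q i - q j)|)) => [i j _|].
    by rewrite normrM mulrC ler_wpM2r.
  by rewrite rowsumZ; apply: is_cvg_seriesZ.
have M0 : 0 <= M by apply: le_trans (fM 0%N).
have sE : edge_summable N (fun i j => c i j * (q j - q i) * (f j - f i)).
  apply: (edge_summable_le finN (H := fun i j =>
    `|c i j * (q i - q j) * (f i - f j)|)) => [i j _|].
    by rewrite le_eqVlt; apply/orP; left; apply/eqP; congr (`|_|); ring.
  apply: sqM => i j; apply: (le_trans (ler_normB _ _)).
  by move: (fM i) (fM j); lra.
have sH : edge_summable N (fun i j => c i j * (q i - q j) * (f i + f j)).
  apply: sqM => i j; apply: (le_trans (ler_normD _ _)).
  by move: (fM i) (fM j); lra.
(* This is f_i = (f_i - f_j) / 2 + (f_i + f_j) / 2 on each edge; the second part is the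
   antisymmetric one. *)
have -> : (fun i => f i * flux q i) =
    2^-1 *: rowsum N (fun i j => c i j * (q j - q i) * (f j - f i)) +
    2^-1 *: rowsum N (fun i j => c i j * (q i - q j) * (f i + f j)).
  have -> : (fun i => f i * flux q i) =
      rowsum N (fun i j => f i * (c i j * (q i - q j))).
    by apply/funext => i; rewrite /flux /rowsum mulr_fsumr.
  by rewrite -!rowsumZ -rowsumD//; apply: eq_rowsum => i j _; field.
rewrite /tsum lim_seriesD; [|exact/is_cvg_seriesZ/edge_summable_cvgn..].
rewrite !lim_seriesZ; [|exact: edge_summable_cvgn..].
rewrite -!/(tsum _) [X in _ + _ *: X](antisym_tsum_eq0 finN symN)//.
  by rewrite scaler0 addr0.
by move=> i j Nij; rewrite (c_sym Nij); ring.
Qed.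

Lemma edge_ge0_tsum_eq0 (F : nat -> nat -> R) :
  (forall i j, N i j -> 0 <= F i j) -> cvgn (series (rowsum N F)) ->
  tsum (rowsum N F) = 0 -> forall i j, N i j -> F i j = 0.
Proof.
move=> F0 cF tF0 i j Nij.
have rF0 := tsum_ge0_eq0 (rowsum_ge0 F0) cF tF0 i.
exact: (pfsumr_eq0 (finN i) (F0 i) rF0 Nij).
Qed.

Lemma energy_eq0_const q : finite_en q -> energy q q = 0 ->
  forall i j, N i j -> q j = q i.
Proof.
move=> eq E0 i j Nij; apply/eqP; rewrite -subr_eq0.
have /eqP : c i j * (q j - q i) * (q j - q i) = 0.
  apply: (edge_ge0_tsum_eq0 _ _ E0 Nij) => [k l Nkl|].
    by rewrite -mulrA mulr_ge0 ?(ltW (c_gt0 Nkl))// -expr2 sqr_ge0.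
  by apply: edge_summable_cvgn => //; exact: finite_en_pair.
by rewrite !mulf_eq0 gt_eqF ?c_gt0//= orbb.
Qed.

Lemma energyC p q : energy p q = energy q p.
Proof. by congr tsum; apply: eq_rowsum => i j _; rewrite mulrAC. Qed.

Lemma energyDl p q r : finite_en p -> finite_en q -> finite_en r ->
  energy (fun i => p i + q i) r = energy p r + energy q r.
Proof.
move=> ep eq er; rewrite /energy /tsum -lim_seriesD.
- rewrite -rowsumD//; congr (limn (series _)).
  by apply: eq_rowsum => i j _; ring.
- exact/edge_summable_cvgn/finite_en_pair.
- exact/edge_summable_cvgn/finite_en_pair.
Qed.

Lemma energyNl p q : finite_en p -> finite_en q ->
  energy (fun i => - p i) q = - energy p q.
Proof.
move=> ep eq; rewrite /energy /tsum -mulN1r -[RHS]lim_seriesZ.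
- rewrite -rowsumZ//; congr (limn (series _)).
  by apply: eq_rowsum => i j _; ring.
- exact/edge_summable_cvgn/finite_en_pair.
Qed.

(** The energy sees only increments along edges, so two potentials of one tangent vector can be
    exchanged once their increments agree. *)
Lemma eq_energyl p q r : (forall i j, N i j -> p j - p i = q j - q i) ->
  energy p r = energy q r.
Proof. by move=> pq; congr tsum; apply: eq_rowsum => i j /pq ->. Qed.

(** * Truncation, and finite-energy functions with zero flux *)

Definition clip (M : R) q i : R := Num.max (- M) (Num.min (q i) M).

Lemma clip_bounded (M : R) q i : 0 <= M -> `|clip M q i| <= M.
Proof.
move=> M0; rewrite /clip ler_norml le_max lexx ge_max ge_min lexx orbT.
by rewrite andbT; lra.
Qed.

Lemma clip_id (M : R) q i : `|q i| <= M -> clip M q i = q i.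
Proof.
rewrite ler_norml => /andP[? ?]; rewrite /clip.
by rewrite min_l// max_r.
Qed.

(** Truncation is nondecreasing; hence every term of the energy of [q] against its truncation is
    nonnegative. *)
Lemma clip_mono (M : R) q i j :
  0 <= (q j - q i) * (clip M q j - clip M q i).
Proof.
wlog qij : i j / q i <= q j.
  move=> W; have [/W//|/ltW/W] := leP (q i) (q j).
  by rewrite -[(q j - _)]opprB -[(clip M q j - _)]opprB mulrNN.
by rewrite mulr_ge0 ?subr_ge0// /clip le_max2// le_min2.
Qed.

(* Green's formula is only available for bounded test functions, so q is
   tested against its truncations. *)
Lemma harmonic_const q : finite_en q -> (forall i, flux q i = 0) ->
  forall i j, N i j -> q j = q i.
Proof.
(* With this [M] the truncation leaves [q] unchanged at both ends of the given edge. *)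
move=> eq q0 i j Nij; pose M := `|q i| + `|q j|; pose f := clip M q.
have M0 : 0 <= M by rewrite addr_ge0.
have fM k : `|f k| <= M by apply: clip_bounded.
have ef : finite_en f.
  apply: (@bounded_finite_en f (2 * M)) => k l.
  by apply: (le_trans (ler_normB _ _)); move: (fM k) (fM l); lra.
have E0 : energy q f = 0.
  apply/eqP; have /eqP := green fM eq.
  rewrite (_ : (fun i => _) = 0 *: flux q); last first.
    by apply/funext => k /=; rewrite q0 mulr0 scale0r.
  rewrite /tsum lim_seriesZ; last exact/abs_summable_cvgn/finite_en_flux_abs.
  by rewrite scale0r mulf_eq0 invr_eq0 pnatr_eq0.
apply/eqP; rewrite -subr_eq0.
have /eqP : c i j * (q j - q i) * (f j - f i) = 0.
  apply: (edge_ge0_tsum_eq0 _ _ E0 Nij) => [k l Nkl|].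
    by rewrite -mulrA mulr_ge0 ?(ltW (c_gt0 Nkl))// clip_mono.
  by apply: edge_summable_cvgn => //; exact: finite_en_pair.
rewrite /f !clip_id ?lerDl ?lerDr//.
by rewrite !mulf_eq0 gt_eqF ?c_gt0//= orbb.
Qed.

End Network.

(** * Bounds for the logarithmic mean *)

Lemma log_mean_bounds (R : realType) (x y : R) : 0 < x -> 0 < y -> x != y ->
  0 < (x - y) / (ln x - ln y) <= x + y.
Proof.
wlog ltyx : x y / y < x.
  move=> W x0 y0 xy; have [yx|xy'|xyE] := ltgtP y x; first exact: W.
    rewrite -[x - y]opprB -[ln x - _]opprB invrN mulrNN (addrC x y).
    by rewrite W// eq_sym.
  by rewrite xyE eqxx in xy.
move=> x0 y0 _.
(* From ln (y / x) <= y / x - 1; it bounds the mean by the larger argument [x]. *)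
have lnyx : x - y <= x * (ln x - ln y).
  have yx0 : 0 < y / x by exact: divr_gt0.
  have /le_ln1Dx : -1 < y / x - 1 by lra.
  rewrite addrC subrK ln_div ?posrE// -(ler_pM2l x0) => h.
  have -> : x - y = - (x * (y / x - 1)) by field; rewrite gt_eqF.
  by rewrite -[ln x - ln y]opprB mulrN lerN2.
have d0 : 0 < ln x - ln y.
  by rewrite -(pmulr_rgt0 _ x0) (lt_le_trans _ lnyx)// subr_gt0.
have xy0 : 0 < x - y by rewrite subr_gt0.
rewrite divr_gt0//= ler_pdivrMr//.
by apply: (le_trans lnyx); rewrite ler_pM2r// lerDl ltW.
Qed.

(** * The weighted graph at a fixed density, seen as a network *)

Section WeightedGraph.
Variables (R : realType) (G : wgraph R).
Hypothesis hG : standing_assumptions G.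
Hypothesis hfin : locally_uniformly_finite G.
Implicit Types p q f sigma : nat -> R.

Lemma nbr_finite i : finite_set (nbr G i).
Proof.
have [CV [_ /(_ i) leCV]] := hfin.
by apply: card_le_finite leCV _; exact: finite_II.
Qed.
Let finN := nbr_finite.

Lemma nbr_sym i j : nbr G i j -> nbr G j i.
Proof. by rewrite /nbr/= (adj_sym hG). Qed.
Let symN := nbr_sym.

Lemma vmeas_gt0 i : 0 < vmeas G i.
Proof. by have [c c0 /(_ i)] := vmeas_inf hG; exact: lt_le_trans. Qed.

Lemma gradE p i j : nbr G i j -> grad G p i j = p j - p i.
Proof. by rewrite /nbr/= /grad => ->. Qed.

Section Density.
Variable rho : nat -> R.
Hypothesis rho_prob0 : prob0 G rho.

Lemma logmean_bounds i j : nbr G i j ->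
  0 < logmean G rho i j <= rho i + rho j.
Proof.
case: rho_prob0 => _ rho0 Nij; rewrite /logmean Nij !rho0/=.
have [<-|rij] := eqVneq; last exact: log_mean_bounds.
by rewrite rho0 lerDl ltW.
Qed.

Lemma logmean_sym i j : logmean G rho i j = logmean G rho j i.
Proof.
rewrite /logmean (adj_sym hG) [X in _ && X]andbC eq_sym.
case: ifP => // _; case: eqVneq => [->//|_].
by rewrite -[RHS]mulrNN -invrN !opprB.
Qed.

Definition cond i j : R := wt G i j * logmean G rho i j.

Lemma cond_gt0 i j : nbr G i j -> 0 < cond i j.
Proof.
move=> Nij; have /andP[l0 _] := logmean_bounds Nij.
by rewrite mulr_gt0// (wt_pos hG).
Qed.

Lemma cond_sym i j : nbr G i j -> cond j i = cond i j.
Proof. by move=> _; rewrite /cond (wt_sym hG) logmean_sym. Qed.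

(** The bound is wt_ij rho_i + wt_ji rho_j: the row sums of the first summand are rho_i pi_i, of
    total mass one, and the second is its transpose. *)
Lemma cond_total : cvgn (series (rowsum (nbr G) cond)).
Proof.
have [[rho_ge0 rho1] _] := rho_prob0.
have w0 i j : nbr G i j -> 0 <= wt G i j * rho i.
  by move=> /(wt_pos hG)/ltW w0; rewrite mulr_ge0.
have c1 : cvgn (series (rowsum (nbr G) (fun i j => wt G i j * rho i))).
  rewrite (_ : rowsum _ _ = fun i => rho i * vmeas G i).
    by apply/cvg_ex; exists 1.
  by apply/funext => i; rewrite /rowsum -mulr_fsuml mulrC.
apply: edge_summable_cvgn => //.
apply: (edge_summable_le finN
  (H := fun i j => wt G i j * rho i + wt G j i * rho j)) => [i j Nij|].
  rewrite (gtr0_norm (cond_gt0 Nij)) (wt_sym hG j i) -mulrDr.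
  rewrite ler_pM2l ?(wt_pos hG)//.
  by have /andP[] := logmean_bounds Nij.
rewrite rowsumD//; apply: is_cvg_seriesD => //.
exact: (swap_cvgn finN symN w0).
Qed.

(** Weighting by the vertex measure cancels its inverse and leaves symmetric conductances. *)
Lemma vmeas_divG p i :
  vmeas G i * divG G rho (grad G p) i = - flux (nbr G) cond p i.
Proof.
rewrite /divG /flux /rowsum mulr_fsumr -mulN1r mulr_fsumr.
apply: eq_fsbigr => j; rewrite inE => Nij; rewrite gradE// /cond.
by field; rewrite gt_eqF// vmeas_gt0.
Qed.

Lemma Bop_vmeas p i : Bop G rho p i * vmeas G i = flux (nbr G) cond p i.
Proof. by rewrite /Bop mulNr mulrC vmeas_divG opprK. Qed.

Lemma BopD p q : Bop G rho (fun i => p i + q i) = Bop G rho p + Bop G rho q.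
Proof.
apply/funext => i; rewrite -[RHS]/(Bop G rho p i + Bop G rho q i).
apply: (mulIf (lt0r_neq0 (vmeas_gt0 i))); rewrite mulrDl !Bop_vmeas.
rewrite /flux -[RHS]/((rowsum _ _ + rowsum _ _) i) -rowsumD//.
by congr (_ i); apply: eq_rowsum => k l _; ring.
Qed.

Lemma BopN p : Bop G rho (fun i => - p i) = - Bop G rho p.
Proof.
apply/funext => i; rewrite -[RHS]/(- Bop G rho p i).
apply: (mulIf (lt0r_neq0 (vmeas_gt0 i))); rewrite [RHS]mulNr !Bop_vmeas.
rewrite /flux -mulN1r -[RHS]/((-1 *: rowsum _ _) i) -rowsumZ.
by congr (_ i); apply: eq_rowsum => k l _; ring.
Qed.

Lemma finite_energyE p : finite_energy G rho p = finite_en (nbr G) cond p.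
Proof.
rewrite /finite_energy /finite_en.
apply: (congr1 (fun u : nat -> R => cvgn (series u))); apply: eq_rowsum.
by move=> i j Nij; rewrite gradE// /cond mulrAC.
Qed.

Lemma dirichletE p q : dirichlet G rho p q = 2^-1 * energy (nbr G) cond p q.
Proof.
congr (_ * tsum _); apply: eq_rowsum.
by move=> i j Nij; rewrite !gradE// /cond; ring.
Qed.

Lemma finite_en_Kspace p : finite_en (nbr G) cond p -> Kspace G rho p.
Proof.
move=> /(finite_en_flux_abs finN cond_gt0 cond_total); rewrite /Kspace /l1.
rewrite /abs_summable (_ : (fun i => `|flux _ _ _ i|) =
  (fun i => `|vmeas G i * divG G rho (grad G p) i|))//.
by apply/funext => i; rewrite vmeas_divG normrN.
Qed.

Lemma finite_en_potential p : finite_en (nbr G) cond p ->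
  potential G rho (Bop G rho p) p.
Proof. by split=> //; [exact: finite_en_Kspace|rewrite finite_energyE]. Qed.

Lemma finite_en_tangent p : finite_en (nbr G) cond p ->
  tangent G rho (Bop G rho p).
Proof.
move=> ep; split; first by exists p => //; exact: finite_en_Kspace.
rewrite -[RHS](flux_tsum_eq0 finN symN cond_gt0 cond_sym cond_total ep).
by congr tsum; apply/funext => i; rewrite Bop_vmeas.
Qed.

Lemma Binv_potential sigma : has_potential G rho sigma ->
  potential G rho sigma (Binv G rho sigma).
Proof. by move=> [p pp]; exact: (xgetPex (fun=> 0) (ex_intro _ p pp)). Qed.

(** The difference of two potentials has finite energy and zero flux, so [harmonic_const] applies to
    it. *)
Lemma potential_unique sigma p q : potential G rho sigma p ->
  potential G rho sigma q -> forall i j, nbr G i j -> p j - p i = q j - q i.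
Proof.
move=> [_ ep Bp] [_ eq Bq] i j Nij; rewrite !finite_energyE in ep eq.
have epq := finite_enD finN cond_gt0 ep (finite_enN eq).
suff /(harmonic_const finN symN cond_gt0 cond_sym cond_total epq)/(_ _ _ Nij) :
    forall k, flux (nbr G) cond (fun i => p i + - q i) k = 0 by lra.
move=> k; rewrite -Bop_vmeas BopD (BopN q) Bp Bq.
by rewrite subrr mul0r.
Qed.

(** Green's formula turns the pairing on the right of the flow equation into a Dirichlet form,
    comparable with [g2]. *)
Lemma dirichlet_ip sigma f q (M : R) : (forall i, `|f i| <= M) ->
  potential G rho sigma q -> dirichlet G rho q f = ip G f sigma.
Proof.
move=> fM [_]; rewrite finite_energyE dirichletE => eq <-.
rewrite (green finN symN cond_gt0 cond_sym cond_total fM eq).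
by congr tsum; apply/funext => i; rewrite -mulrA Bop_vmeas.
Qed.

(** The flow equation at one fixed time, with [phi] in the role of the derivative of J. *)
Lemma gradient_flow_atP phi sigma0 (M : R) :
  (forall i j, `|phi i - phi j| <= M) ->
  [/\ tangent G rho sigma0, has_potential G rho sigma0 &
      forall sigma, tangent G rho sigma -> has_potential G rho sigma ->
        g2 G rho sigma0 sigma = - ip G phi sigma] <->
  (forall i, sigma0 i = - Bop G rho phi i).
Proof.
move=> phiM.
(* Anchoring at vertex 0 turns bounded oscillation into the bound that Green's formula requires. *)
have phib i : `|phi i| <= `|phi 0%N| + M.
  by rewrite -[phi i](subrK (phi 0%N)) addrC (le_trans (ler_normD _ _))// lerD.
have ephi := bounded_finite_en finN cond_gt0 cond_total phiM.
split=> [[_ pot0 flow] i|sigma0E].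
  have pot1 := Binv_potential pot0.
  set p1 := Binv G rho sigma0 in pot1; have [_ e1 B1] := pot1.
  rewrite finite_energyE in e1.
  (* The claim amounts to B q = 0, so the flow equation is tested in the direction B q. *)
  pose q i := p1 i + phi i.
  have eq : finite_en (nbr G) cond q := finite_enD finN cond_gt0 e1 ephi.
  have potq := finite_en_potential eq.
  have hasq : has_potential G rho (Bop G rho q) by exists q.
  have pot2 := Binv_potential hasq.
  have := flow _ (finite_en_tangent eq) hasq.
  rewrite -(dirichlet_ip phib pot2) /g2 -/p1.
  (* The potential that [Binv] picks for B q may differ from [q], but it has the same increments
     along edges. *)
  set p2 := Binv _ _ _ in pot2 *; have [_ e2 _] := pot2.
  rewrite finite_energyE in e2.
  have p2q := potential_unique pot2 potq.
  rewrite !dirichletE energyC !(eq_energyl _ _ p2q) => E12.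
  (* E(q, q) = E(p1, q) + E(phi, q), and the tested flow equation says that the two terms cancel. *)
  have E0 : energy (nbr G) cond q q = 0.
    rewrite {1}/q (energyDl finN cond_gt0 e1 ephi eq).
    move: E12; rewrite [energy _ _ q p1]energyC [energy _ _ q phi]energyC.
    by lra.
  have qc := energy_eq0_const finN cond_gt0 eq E0.
  apply/eqP; rewrite -addr_eq0 -B1 -[_ + _]/((Bop G rho p1 + Bop G rho phi) i).
  rewrite -BopD; apply/eqP/(mulIf (lt0r_neq0 (vmeas_gt0 i))).
  rewrite mul0r Bop_vmeas; apply: fsbig1 => j /qc.
  by rewrite /q => ->; rewrite subrr mulr0.
(* For the converse, - phi is an explicit potential of the velocity. *)
have {sigma0E} -> : sigma0 = Bop G rho (fun i => - phi i).
  by rewrite BopN; apply/funext => i; rewrite sigma0E.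
have eN := finite_enN ephi; have potN := finite_en_potential eN.
split; [exact: finite_en_tangent|by exists (fun i => - phi i)|].
move=> sigma _ hs; have pots := Binv_potential hs.
have [_ es _] := pots; rewrite finite_energyE in es.
have hN : has_potential G rho (Bop G rho (fun i => - phi i)).
  by exists (fun i => - phi i).
rewrite /g2 -(dirichlet_ip phib pots) !dirichletE.
rewrite (eq_energyl _ _ (potential_unique (Binv_potential hN) potN)).
by rewrite (energyNl finN cond_gt0 ephi es) [in RHS]energyC mulrN.
Qed.

End Density.

(** * Mass transfers and the oscillation of the derivative of J *)

Lemma l1norm0 : l1norm G 0 = 0.
Proof.
rewrite /l1norm (@tsum_pair _ _ 0%N 1%N)// => [|k _ _]; rewrite normr0 !mulr0//.
by rewrite addr0.
Qed.

(* The velocity of the curve moving the mass of j to i at constant speed. *)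
Definition transfer (rho : nat -> R) (i j k : nat) : R :=
  if k == i then rho j * vmeas G j / vmeas G i
  else if k == j then - rho j else 0.

Section Transfer.
Variables (rho : nat -> R) (i j : nat).
Hypothesis rho_prob : prob G rho.
Hypothesis ij : i != j.
Let tau := transfer rho i j.
(** At time s the vertex [j] has density (1 - s) rho_j, so the curve stays in P(G) until s = 1. *)
Let curve (s : R) : nat -> R := rho + s *: tau.

Let tau_i : tau i = rho j * vmeas G j / vmeas G i.
Proof. by rewrite /tau /transfer eqxx. Qed.

Let tau_j : tau j = - rho j.
Proof. by rewrite /tau /transfer eq_sym (negbTE ij) eqxx. Qed.

Let tau_out k : k != i -> k != j -> tau k = 0.
Proof. by move=> /negbTE ki /negbTE kj; rewrite /tau /transfer ki kj. Qed.

Let tau_scale (s : R) k : (s *: tau) k = s * tau k.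
Proof. by []. Qed.

Lemma transfer_scale_l1 (s : R) : l1 G (s *: tau).
Proof.
apply/cvg_ex; eexists; apply: (series_pair_cvg ij) => k ki kj.
by rewrite tau_scale tau_out// mulr0 mulr0 normr0.
Qed.

Lemma transfer_scale_l1_zero (s : R) : l1_zero G (s *: tau).
Proof.
split; first exact: transfer_scale_l1.
rewrite (tsum_pair ij) => [|k ki kj]; rewrite !tau_scale.
  by rewrite tau_i tau_j; field; rewrite gt_eqF// vmeas_gt0.
by rewrite tau_out// mulr0 mul0r.
Qed.

Lemma l1norm_transfer_scale (s : R) :
  l1norm G (s *: tau) = `|s| * (2 * (rho j * vmeas G j)).
Proof.
have [rho0 _] := rho_prob; have v0 := vmeas_gt0.
rewrite /l1norm (tsum_pair ij) => [|k ki kj]; rewrite !tau_scale.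
  rewrite tau_i tau_j !normrM normfV normrN.
  rewrite (ger0_norm (rho0 j)) !(gtr0_norm (v0 _)).
  by field; rewrite gt_eqF.
by rewrite tau_out// mulr0 normr0 mulr0.
Qed.

Lemma ip_transfer (f : nat -> R) :
  ip G f tau = (f i - f j) * (rho j * vmeas G j).
Proof.
rewrite /ip (tsum_pair ij) => [|k ki kj].
  by rewrite tau_i tau_j; field; rewrite gt_eqF// vmeas_gt0.
by rewrite tau_out// mulr0 mul0r.
Qed.

Lemma transfer_curve_prob (s : R) : 0 <= s <= 1 -> prob G (curve s).
Proof.
move=> /andP[s0 s1]; have [rho0 rho1] := rho_prob.
have v0 k : 0 <= vmeas G k by rewrite ltW// vmeas_gt0.
split.
  move=> k; rewrite -[curve s k]/(rho k + s * tau k).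
  rewrite /tau /transfer; case: eqVneq => [_|ki].
    by rewrite addr_ge0// mulr_ge0// divr_ge0// mulr_ge0.
  by case: eqVneq => [->|kj]; [have := rho0 j; nra|rewrite mulr0 addr0].
rewrite (_ : (fun k => curve s k * vmeas G k) =
  (fun k => rho k * vmeas G k) + (fun k => (s *: tau) k * vmeas G k));
  last first.
  by apply/funext => k; rewrite -[LHS]/((rho k + s * tau k) * _) mulrDl.
rewrite seriesD -[X in _ --> X]addr0; apply: cvgD => //.
(* The limit 0 is written as the sum of the perturbation, so that mere convergence suffices. *)
have [_ <-] := transfer_scale_l1_zero s.
apply: cvgP; apply: (series_pair_cvg ij) => k ki kj.
by rewrite tau_scale tau_out// mulr0 mul0r.
Qed.

Lemma transfer_C1_curve : C1_prob_curve G curve (fun=> tau).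
Proof.
move=> t t01; split; first exact: transfer_curve_prob.
- by rewrite -[tau]scale1r; exact: transfer_scale_l1.
(* The curve is affine, so its difference quotient is exactly [tau]. *)
- apply: cvg_near_cst; rewrite near_withinE; near=> s => _.
  rewrite (_ : _ *: (_ - _) - _ = 0) ?l1norm0//; apply/funext => k.
  rewrite -[LHS]/((s - t)^-1 * ((rho k + s * tau k) - (rho k + t * tau k))
                  - tau k).
  rewrite -[RHS]/(0 : R); field; rewrite subr_eq0.
  by near: s; exact: nbhs_dnbhs_neq.
- by apply: cvg_near_cst; apply: nearW => s; rewrite subrr l1norm0.
Unshelve. all: by end_near. Qed.

(** Put e = rho_j pi_j. Along the transfer J has initial derivative (phi_i - phi_j) e, while the
    curve moves a distance 2 e s in time s; the Frechet bound gives at most 2 e (C + 1), and e > 0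
    cancels. *)
Lemma var_deriv_osc_pair (J : (nat -> R) -> R) (dJ : (nat -> R) -> nat -> R)
    (D : (nat -> R) -> R) (C d : R) :
  0 < rho j -> 0 < d ->
  (forall sigma, l1_zero G sigma -> `|D sigma| <= C * l1norm G sigma) ->
  (forall mu, prob G mu -> l1norm G (mu - rho) < d ->
    `|J mu - J rho - D (mu - rho)| <= l1norm G (mu - rho)) ->
  var_deriv G J dJ -> `|dJ rho i - dJ rho j| <= 2 * (C + 1).
Proof.
move=> rj0 d0 DC JD /(_ _ _ transfer_C1_curve 0) [].
  by rewrite lexx ler01.
have curve0 : curve 0 = rho by rewrite /curve scale0r addr0.
rewrite curve0 ip_transfer => _.
set e := rho j * vmeas G j; have e0 : 0 < e by rewrite mulr_gt0 ?vmeas_gt0.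
have e20 : 0 < 2 * e by lra.
move=> /(cvg_trans (cvg_app _ (@at_right_within01 R)))/cvg_norm nJ.
rewrite -(ler_pM2r e0) -[X in `|_| * X](gtr0_norm e0) -normrM.
apply: (cvgr_to_le nJ).
near=> s.
have s0 : 0 < s by near: s; exact: nbhs_right_gt.
have s1 : s <= 1 by near: s; exact: nbhs_right_le.
(* Keeps the curve in the ball of radius [d] where the first-order expansion holds. *)
have sd : s < d / (2 * e).
  by near: s; apply: nbhs_right_lt; rewrite divr_gt0.
have curveB : curve s - rho = s *: tau by rewrite /curve addrC addKr.
have nB : l1norm G (curve s - rho) = s * (2 * e).
  by rewrite curveB l1norm_transfer_scale gtr0_norm.
have pc : prob G (curve s) by apply: transfer_curve_prob; rewrite s1 ltW.
rewrite ltr_pdivlMr// in sd.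
have := JD _ pc; rewrite nB => /(_ sd) h2.
have := DC _ (transfer_scale_l1_zero s); rewrite -curveB nB => h1.
rewrite subr0/= curve0 normrM normfV (gtr0_norm s0) ler_pdivrMr//.
(* The increment of J is the remainder, at most the distance, plus the linear part, at most C times
   the distance. *)
rewrite -[J _ - _](subrK (D (curve s - rho))).
apply: (le_trans (ler_normD _ _)); lra.
Unshelve. all: by end_near. Qed.

End Transfer.

(** The constants [C] and [d], taken at [rho] with tolerance 1, do not depend on the pair of
    vertices, so the bound is uniform. *)
Lemma var_deriv_osc (J : (nat -> R) -> R) (dJ : (nat -> R) -> nat -> R) rho :
  C2_prob G J -> var_deriv G J dJ -> prob0 G rho ->
  exists M : R, forall i j, `|dJ rho i - dJ rho j| <= M.
Proof.
move=> [D [D2 DP]] hdJ [prho rho0].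
have [[_ [C DC]] _ /(_ 1 ltr01) [d d0 Jd]] := DP _ prho.
(* The absolute value keeps the bound nonnegative, as the case i = j demands. *)
exists (2 * (`|C| + 1)) => i j.
have [->|ij] := eqVneq i j; first by rewrite subrr normr0 mulr_ge0// addr_ge0.
apply: le_trans (_ : 2 * (C + 1) <= _); last by have := ler_norm C; lra.
apply: (var_deriv_osc_pair prho ij (rho0 j) d0 DC _ hdJ).
by move=> mu pmu lmu; have [+ _ _] := Jd _ pmu lmu; rewrite mul1r.
Qed.

End WeightedGraph.

Unset Implicit Arguments.

Theorem lemma3p6 (R : realType) (G : wgraph R)
  (hG : standing_assumptions G)
  (hconn : connected_graph G)
  (hfin : locally_uniformly_finite G)
  (hsc : stochastically_complete G)
  (J : (nat -> R) -> R) (dJ : (nat -> R) -> nat -> R)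
  (hJ : C2_prob G J)
  (hdJ : var_deriv G J dJ)
  (hK : forall rho, prob0 G rho -> Kspace G rho (dJ rho))
  (I : interval R) (rho drho : R -> nat -> R)
  (hrho : prob0_curve G I rho drho) :
  (gradient_flow G dJ I rho drho <->
     forall t : R, t \in I -> forall i, drho t i = - Bop G (rho t) (dJ (rho t)) i)
  /\
  (gradient_flow G dJ I rho drho <->
     forall t : R, t \in I -> forall i,
       drho t i = divG G (rho t) (grad G (dJ (rho t))) i).
Proof.
(* The equivalence is local in time: at each t the density lies in P_0(G), where the derivative of J
   has bounded oscillation. *)
have flowP t : t \in I ->
    [/\ tangent G (rho t) (drho t), has_potential G (rho t) (drho t) &
      forall sigma, tangent G (rho t) sigma -> has_potential G (rho t) sigma ->
        g2 G (rho t) (drho t) sigma = - ip G (dJ (rho t)) sigma] <->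
    (forall i, drho t i = - Bop G (rho t) (dJ (rho t)) i).
  move=> /hrho[prho _]; have [M osc] := var_deriv_osc hG hJ hdJ prho.
  exact: (gradient_flow_atP hG hfin prho (drho t) osc).
have flowB : gradient_flow G dJ I rho drho <->
    forall t : R, t \in I ->
      forall i, drho t i = - Bop G (rho t) (dJ (rho t)) i.
  by split=> flow t tI; apply/(flowP t tI)/flow.
split=> //; apply: (iff_trans flowB).
by split=> flow t tI i; rewrite (flow t tI i) /Bop opprK.
Qed.
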